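(* Let $P\subset N_{\mathbb{Q}}$ be a lattice polytope with the origin in its strict interior. Then, up to isomorphism, there are only finitely many combinatorial mutations $\mathrm{mut}_w(P,F)$ of $P$ (as $w$ ranges over all primitive vectors of $M$ and $F$ over all factors for $P$ with respect to $w$).
   Context: $N$ is a lattice of rank $n$, $N_{\mathbb{Q}}=N\otimes\mathbb{Q}$, $M=\mathrm{Hom}(N,\mathbb{Z})$. Polytopes are convex; a lattice polytope has vertices in $N$; $\mathcal{V}(P)$ denotes the vertex set of $P$. Two lattice polytopes in $N_{\mathbb{Q}}$ are isomorphic if one is carried to the other by a lattice automorphism of $N$ (an element of $\mathrm{GL}_n(\mathbb{Z})$). Combinatorial mutation: let $w\in M$ be a primitive lattice vector and $P\subset N_{\mathbb{Q}}$ a lattice polytope. Set $h_{\min}=\min\{w(v)\mid v\in P\}$, $h_{\max}=\max\{w(v)\mid v\in P\}$. For $h\in\mathbb{Z}$ let $H_{w,h}=\{x\in N_{\mathbb{Q}}\mid w(x)=h\}$ and $w_h(P)=\mathrm{conv}(H_{w,h}\cap P\cap N)$. Minkowski sum is $Q+R=\{q+r\mid q\in Q,r\in R\}$, with the convention $Q+\varnothing=\varnothing$. A (nonempty) lattice polytope $F\subset N_{\mathbb{Q}}$ with $w(F)=0$ is called a factor for $P$ with respect to $w$ if for every integer $h_{\min}\le h<0$ there exists a possibly empty lattice polytope $G_h\subset N_{\mathbb{Q}}$ with $$H_{w,h}\cap\mathcal{V}(P)\subseteq G_h+(-h)F\subseteq w_h(P).$$ Given such $w$, $F$, $\{G_h\}$,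 the combinatorial mutation is the lattice polytope $$\mathrm{mut}_w(P,F;\{G_h\})=\mathrm{conv}\left(\bigcup_{h=h_{\min}}^{-1}G_h\cup\bigcup_{h=0}^{h_{\max}}(w_h(P)+hF)\right).$$ This is independent of the choice of $\{G_h\}$, and is written $\mathrm{mut}_w(P,F)$. *)

(* Defs.v *)
(* MathComp / MathComp-Analysis.  The lattice is N = Z^n, in column vectors;
   M = Hom(N, Z) is Z^n in row vectors, acting by the matrix product; subsets of
   N_Q = Q^n are sets of rational column vectors. *)
From HB Require Import structures.
From mathcomp Require Import all_boot all_order all_algebra.
From mathcomp Require Import all_classical all_reals all_analysis.

Set Implicit Arguments.
Unset Strict Implicit.
Unset Printing Implicit Defensive.

Import Order.TTheory GRing.Theory Num.Theory.
Local Open Scope classical_set_scope.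
Local Open Scope ring_scope.

Definition lattice_points n : set 'cV[rat]_n :=
  range (fun v : 'cV[int]_n => map_mx intr v).

Definition pairing n (w : 'rV[int]_n) (x : 'cV[rat]_n) : rat :=
  (map_mx intr w *m x) 0 0.

Definition primitive n (w : 'rV[int]_n) : Prop :=
  w != 0 /\ forall (k : int) (u : 'rV[int]_n), w = k *: u -> `|k|%N = 1%N.

Definition conv_hull n (A : set 'cV[rat]_n) : set 'cV[rat]_n :=
  smallest (@convex_set rat 'cV[rat]_n) A.

(* The empty set is a polytope; nonemptiness is required separately. *)
Definition polytope n (P : set 'cV[rat]_n) : Prop :=
  exists2 A : set 'cV[rat]_n, finite_set A & P = conv_hull A.

(* Vertices as extreme points. *)
Definition vertices n (P : set 'cV[rat]_n) : set 'cV[rat]_n :=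
  [set v | P v /\ forall (x y : 'cV[rat]_n) (t : rat),
    P x -> P y -> 0 < t < 1 -> v = t *: x + (1 - t) *: y -> x = v /\ y = v].

Definition lattice_polytope n (P : set 'cV[rat]_n) : Prop :=
  polytope P /\ vertices P `<=` @lattice_points n.

Definition lattice_iso n (P Q : set 'cV[rat]_n) : Prop :=
  exists2 U : 'M[int]_n, U \in unitmx & [set map_mx intr U *m x | x in P] = Q.

Definition iso_class n (P : set 'cV[rat]_n) : set (set 'cV[rat]_n) :=
  [set Q | lattice_iso P Q].

Definition minkowski n (Q R : set 'cV[rat]_n) : set 'cV[rat]_n :=
  [set q + r | q in Q & r in R].

Definition dilate n (k : int) (F : set 'cV[rat]_n) : set 'cV[rat]_n :=
  [set k%:~R *: x | x in F].

(* The default value 0 is taken only if the minimum (maximum) does not exist,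
   which does not happen for a nonempty polytope. *)
Definition h_min n (w : 'rV[int]_n) (P : set 'cV[rat]_n) : rat :=
  xget 0 ((pairing w @` P) `&` lbound (pairing w @` P)).

Definition h_max n (w : 'rV[int]_n) (P : set 'cV[rat]_n) : rat :=
  xget 0 ((pairing w @` P) `&` ubound (pairing w @` P)).

Definition hyperplane n (w : 'rV[int]_n) (h : int) : set 'cV[rat]_n :=
  [set x | pairing w x = h%:~R].

(* w_h(P) *)
Definition slice n (w : 'rV[int]_n) (h : int) (P : set 'cV[rat]_n) :
    set 'cV[rat]_n :=
  conv_hull (hyperplane w h `&` P `&` @lattice_points n).

Definition neg_heights n (w : 'rV[int]_n) (P : set 'cV[rat]_n) : set int :=
  [set h | h_min w P <= h%:~R /\ h < 0].

Definition nonneg_heights n (w : 'rV[int]_n) (P : set 'cV[rat]_n) : set int :=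
  [set h | 0 <= h /\ h%:~R <= h_max w P].

Definition compatible n (w : 'rV[int]_n) (P F : set 'cV[rat]_n) (h : int)
    (Gh : set 'cV[rat]_n) : Prop :=
  [/\ lattice_polytope Gh,
      hyperplane w h `&` vertices P `<=` minkowski Gh (dilate (- h) F) &
      minkowski Gh (dilate (- h) F) `<=` slice w h P].

Definition is_factor n (w : 'rV[int]_n) (P F : set 'cV[rat]_n) : Prop :=
  [/\ lattice_polytope F, F !=set0, F `<=` hyperplane w 0 &
      forall h, neg_heights w P h -> exists Gh, compatible w P F h Gh].

Definition mut n (w : 'rV[int]_n) (P F : set 'cV[rat]_n)
    (G : int -> set 'cV[rat]_n) : set 'cV[rat]_n :=
  conv_hull ((\bigcup_(h in neg_heights w P) G h) `|`
    \bigcup_(h in nonneg_heights w P) minkowski (slice w h P) (dilate h F)).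

(* All admissible families G are allowed, so the independence of mut_w(P,F)
   from G is not presupposed. *)
Definition mutations n (P : set 'cV[rat]_n) : set (set 'cV[rat]_n) :=
  [set Q | exists (w : 'rV[int]_n) (F : set 'cV[rat]_n)
      (G : int -> set 'cV[rat]_n),
    [/\ primitive w, is_factor w P F,
        forall h, neg_heights w P h -> compatible w P F h (G h) &
        Q = mut w P F G]].

(* Main.v *)
(* Let f be a lattice point of the factor F.  The shear x |-> x - w(x) f maps
   mut_w(P,F) to a polytope Q'.  If F = {f}, then Q' = P.  Otherwise F has two
   lattice points, so the slice of P at height h_min contains two points whose
   difference is h_min times a nonzero lattice vector; as P is bounded, this
   bounds |h_min|.  Since 0 is interior to P, a bound on h_min bounds the
   coefficients of w, hence also h_max.  As x + |h_min| F lies in P for some x,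
   F - f is bounded as well.  Therefore Q' lies in a box that depends only on P,
   and Q' is the convex hull of its lattice points: there are finitely many
   such Q'. *)
Require Import Defs.
From mathcomp Require Import all_boot all_order all_algebra.
From mathcomp Require Import all_classical all_reals all_analysis.
From mathcomp Require Import ring lra zify.

Set Implicit Arguments.
Unset Strict Implicit.
Unset Printing Implicit Defensive.

Import Order.TTheory GRing.Theory Num.Theory.
Local Open Scope classical_set_scope.
Local Open Scope ring_scope.

(** * Convex sets and convex hulls *)

Lemma convex_setP n (A : set 'cV[rat]_n) :
  @convex_set rat 'cV[rat]_n A <->
  forall x y (t : rat), A x -> A y -> 0 <= t <= 1 -> A (t *: x + (1 - t) *: y).
Proof.
split=> [cA x y t Ax Ay /andP[t0 t1]|cA x y t].
  by have := cA x y (Itv01 t0 t1); rewrite !inE; apply.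
by rewrite !inE => Ax Ay; apply: cA => //; apply/andP; split.
Qed.

Lemma convex_conv_hull n (A : set 'cV[rat]_n) :
  @convex_set rat 'cV[rat]_n (conv_hull A).
Proof.
apply/convex_setP => x y t Ax Ay t01 C [cC AC].
by have /convex_setP := cC; apply; [exact: Ax|exact: Ay|].
Qed.

Lemma sub_conv_hull n (A : set 'cV[rat]_n) : A `<=` conv_hull A.
Proof. exact: sub_gen_smallest. Qed.

Lemma conv_hull_min n (A C : set 'cV[rat]_n) :
  @convex_set rat 'cV[rat]_n C -> A `<=` C -> conv_hull A `<=` C.
Proof. exact: smallest_sub. Qed.

Lemma conv_hullS n (A B : set 'cV[rat]_n) :
  A `<=` B -> conv_hull A `<=` conv_hull B.
Proof.
move=> AB; apply: conv_hull_min; first exact: convex_conv_hull.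
exact: subset_trans AB (@sub_conv_hull _ _).
Qed.

Lemma conv_hull0 n : conv_hull (set0 : set 'cV[rat]_n) = set0.
Proof. by apply: smallest_id; apply/convex_setP. Qed.

Lemma convex_set1 n (a : 'cV[rat]_n) : @convex_set rat 'cV[rat]_n [set a].
Proof.
by apply/convex_setP => _ _ t -> -> _; rewrite -scalerDl subrKC scale1r.
Qed.

(** Stated on two-point combinations, the form in which convexity is tested; matrix products,
    scalings and translations are all covered. *)
Definition affine_map m n (f : 'cV[rat]_m -> 'cV[rat]_n) : Prop :=
  forall x y t, f (t *: x + (1 - t) *: y) = t *: f x + (1 - t) *: f y.

Lemma convex_preimage m n (f : 'cV[rat]_m -> 'cV[rat]_n) (C : set 'cV[rat]_n) :
  affine_map f -> @convex_set rat 'cV[rat]_n C ->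
  @convex_set rat 'cV[rat]_m (f @^-1` C).
Proof.
move=> af /convex_setP cC; apply/convex_setP => x y t Cx Cy t01 /=.
by rewrite /preimage /= af; exact: cC.
Qed.

Lemma convex_image m n (f : 'cV[rat]_m -> 'cV[rat]_n) (C : set 'cV[rat]_m) :
  affine_map f -> @convex_set rat 'cV[rat]_m C ->
  @convex_set rat 'cV[rat]_n (f @` C).
Proof.
move=> af /convex_setP cC; apply/convex_setP => _ _ t [x Cx <-] [y Cy <-] t01.
by exists (t *: x + (1 - t) *: y); [exact: cC|exact: af].
Qed.

Lemma image_conv_hull m n (f : 'cV[rat]_m -> 'cV[rat]_n) (A : set 'cV[rat]_m) :
  affine_map f -> f @` conv_hull A `<=` conv_hull (f @` A).
Proof.
move=> af _ [x Ax <-]; move: x Ax.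
apply: (@conv_hull_min _ A (f @^-1` conv_hull (f @` A))).
  exact/convex_preimage/convex_conv_hull.
by move=> x Ax; apply: sub_conv_hull; exists x.
Qed.

Lemma affine_mulmx m n (M : 'M[rat]_(n, m)) : affine_map (fun x => M *m x).
Proof. by move=> x y t; rewrite mulmxDr -!scalemxAr. Qed.

Lemma affine_scale n (k : rat) : affine_map (fun x : 'cV[rat]_n => k *: x).
Proof. by move=> x y t; rewrite scalerDr !scalerA ![k * _]mulrC. Qed.

Lemma affine_addr n (b : 'cV[rat]_n) : affine_map (fun x => x + b).
Proof.
move=> x y t; rewrite !scalerDr addrACA; congr (_ + _).
by rewrite -scalerDl subrKC scale1r.
Qed.

Lemma affine_addl n (b : 'cV[rat]_n) : affine_map (fun x => b + x).
Proof. by move=> x y t; rewrite addrC affine_addr ![b + _]addrC. Qed.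

(** * Polytopes as hulls of their vertices *)

(** Convexity in homogeneous form: the weights need not sum to 1, so later computations avoid
    division. If [a + b = 0], both weights vanish and any point serves as [z]. *)
Lemma convex_cone_comb n (C : set 'cV[rat]_n) (a b : rat) (x y : 'cV[rat]_n) :
  @convex_set rat 'cV[rat]_n C -> C x -> C y -> 0 <= a -> 0 <= b ->
  exists2 z, C z & a *: x + b *: y = (a + b) *: z.
Proof.
move=> /convex_setP cC Cx Cy a0 b0.
have [ab0|ab0] := eqVneq (a + b) 0.
  exists x => //; have [-> ->] : a = 0 /\ b = 0 by split; lra.
  by rewrite addr0 !scale0r addr0.
have abp : 0 < a + b by rewrite lt0r ab0 addr_ge0.
exists (a / (a + b) *: x + (1 - a / (a + b)) *: y).
  apply: cC => //; rewrite divr_ge0 ?addr_ge0//=.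
  by rewrite ler_pdivrMr// mul1r lerDl.
rewrite scalerDr !scalerA mulrBr mulr1 mulrCA mulfV// mulr1.
by congr (_ + _ *: _); ring.
Qed.

(** The union of the segments from [a] to the hull of [B] contains [a] and [B], and it is convex
    because the two weighted points of the hull merge into one. *)
Lemma conv_hullU1 n (a : 'cV[rat]_n) (B : set 'cV[rat]_n) x :
  B !=set0 -> conv_hull (a |` B) x ->
  exists b t, [/\ conv_hull B b, 0 <= t <= 1 & x = t *: a + (1 - t) *: b].
Proof.
move=> [b0 Bb0].
set C := [set x | exists b t,
  [/\ conv_hull B b, 0 <= t <= 1 & x = t *: a + (1 - t) *: b]].
suff HC : conv_hull (a |` B) `<=` C by exact: HC.
apply: conv_hull_min => [|x0 [->|Bx0]].
- apply/convex_setP => _ _ s [b [l [Bb l01 ->]]] [c [m [Bc m01 ->]]] s01.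
  have [d Bd dE] := @convex_cone_comb _ _ (s * (1 - l)) ((1 - s) * (1 - m)) b c
    (@convex_conv_hull _ B) Bb Bc ltac:(nra) ltac:(nra).
  exists d, (s * l + (1 - s) * m); split=> //; first by apply/andP; split; nra.
  rewrite !scalerDr !scalerA addrACA dE -scalerDl.
  by congr (_ + _ *: _); ring.
- exists b0, 1; split; [exact: sub_conv_hull|by rewrite ler01 lexx|].
  by rewrite subrr scale0r scale1r addr0.
- exists x0, 0; split; [exact: sub_conv_hull|by rewrite ler01 lexx|].
  by rewrite subr0 scale0r scale1r add0r.
Qed.

(* If [a = t x + (1 - t) y] with [x] and [y] in the hull, then splitting off
   the weight of [a] in [x] and [y] exhibits [a] in the hull of [B], unless
   that weight is 1 in both. *)
Lemma vertex_conv_hullU1 n (a : 'cV[rat]_n) (B : set 'cV[rat]_n) :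
  ~ conv_hull B a -> vertices (conv_hull (a |` B)) a.
Proof.
move=> Ba; split; first by apply: sub_conv_hull; left.
move=> x y t.
have [->|/set0P B0] := eqVneq B set0.
  by rewrite setU0 [conv_hull _](smallest_id (@convex_set1 n a)) => -> ->.
move=> /(conv_hullU1 B0)[b [l [Bb l01 xE]]].
move=> /(conv_hullU1 B0)[c [m [Bc m01 yE]]] t01 aE.
have [d Bd dE] := @convex_cone_comb _ _ (t * (1 - l)) ((1 - t) * (1 - m)) b c
    (@convex_conv_hull _ B) Bb Bc ltac:(nra) ltac:(nra).
set k := t * (1 - l) + (1 - t) * (1 - m) in dE.
have kE : k *: a = k *: d.
  rewrite -dE /k; apply/eqP; rewrite -subr_eq0; apply/eqP.
  transitivity (a - (t *: x + (1 - t) *: y)); last by rewrite -aE subrr.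
  by rewrite xE yE; apply/matrixP => i j; rewrite !mxE; ring.
have [k0|k0] := eqVneq k 0; last first.
  by case: Ba; rewrite (scalerI k0 kE).
have [l1 m1] : l = 1 /\ m = 1 by move: k0; rewrite /k => k0; split; nra.
by rewrite xE yE l1 m1 subrr !scale0r !scale1r !addr0.
Qed.

(* A sequence of generators none of which lies in the hull of the others
   consists of vertices. *)
Lemma polytope_vertices n (P : set 'cV[rat]_n) : polytope P ->
  exists S : seq 'cV[rat]_n,
    [set` S] `<=` vertices P /\ P = conv_hull [set` S].
Proof.
move=> [A /finite_seqP[s ->] ->] {A P}.
elim: {s}(size s) {-2}s (leqnn (size s)) => [|k IH] s sk.
  by exists [::]; case: s sk => // _; split.
(* Either some generator is redundant, and deleting all its copies shortens the list without
   changing the hull, or the list already consists of vertices. *)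
have [[a sa aE]|nred] := pselect (exists2 a, a \in s &
    conv_hull [set x | x \in s /\ x != a] a).
  set s' := [seq x <- s | x != a].
  have s'E : [set x | x \in s /\ x != a] = [set` s'].
    apply/seteqP; split=> x /=; rewrite mem_filter; first by case=> -> ->.
    by case/andP.
  rewrite s'E in aE.
  have -> : conv_hull [set` s] = conv_hull [set` s'].
    apply/seteqP; split; last first.
      by apply: conv_hullS => x /=; rewrite mem_filter => /andP[].
    apply: conv_hull_min; first exact: convex_conv_hull.
    move=> x /= xs; have [->//|xa] := eqVneq x a.
    by apply: sub_conv_hull; rewrite /= mem_filter xa.
  apply: IH; rewrite -ltnS; apply: leq_trans sk.
  by rewrite size_filter -(count_predC (pred1 a) s) -[X in (X < _)%N]add0n
    ltn_add2r -has_count has_pred1.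
exists s; split=> // a /= sa.
have -> : [set` s] = a |` [set x | x \in s /\ x != a].
  apply/seteqP; split=> x /=; last by case=> [->//|[]].
  by move=> xs; have [->|xa] := eqVneq x a; [left|right].
by apply: vertex_conv_hullU1 => aB; apply: nred; exists a.
Qed.

(** * Sets contained in the hull of their lattice points *)

(** A property of lattice polytopes that passes to unions, Minkowski sums and hulls without a study
    of vertices. A convex set with it is determined by its lattice points. *)
Definition lattice_generated n (X : set 'cV[rat]_n) : Prop :=
  X `<=` conv_hull (X `&` @lattice_points n).

Lemma lattice_polytope_seq n (P : set 'cV[rat]_n) : lattice_polytope P ->
  exists S : seq 'cV[int]_n,
    [/\ P = conv_hull [set map_mx intr v | v in [set` S]],
        P = set0 <-> S = [::] &
        forall v, v \in S -> vertices P (map_mx intr v)].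
Proof.
move=> [/polytope_vertices[S [Svert PE]] latP].
have latS v : v \in S -> exists u : 'cV[int]_n, map_mx intr u = v.
  by move=> /Svert /latP[u _ <-]; exists u.
have [T TE] : exists T : seq 'cV[int]_n, [seq map_mx intr u | u <- T] = S.
  elim: S latS {Svert PE} => [|v S IH] latS; first by exists [::].
  have [|T <-] := IH; first by move=> u uS; apply: latS; rewrite inE uS orbT.
  by have [u <-] := latS v (mem_head _ _); exists (u :: T).
have imE : [set map_mx intr v | v in [set` T]] = [set` S].
  rewrite -TE; apply/seteqP; split=> x /=; last by case/mapP => u; exists u.
  by case=> u uT <-; exact: map_f.
exists T; split; first by rewrite imE.
- split=> [P0|T0]; last first.
    rewrite PE -imE T0 (_ : [set _ | _ in _] = set0) ?conv_hull0//.
    by rewrite -subset0 => x [].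
  case: T {TE} imE => // v T imE; suff: P (map_mx intr v) by rewrite P0.
  by rewrite PE -imE; apply: sub_conv_hull; exists v => //=; rewrite mem_head.
- by move=> v vT; apply: Svert; rewrite /= -TE map_f.
Qed.

Lemma lattice_polytope_generated n (P : set 'cV[rat]_n) :
  lattice_polytope P -> lattice_generated P.
Proof.
move=> /lattice_polytope_seq[S [PE _ SP]]; rewrite /lattice_generated {1}PE.
apply: conv_hullS.
move=> _ [v vS <-]; split; last by exists v.
by have [] := SP _ vS.
Qed.

Lemma lattice_generated_conv_hull n (X : set 'cV[rat]_n) :
  lattice_generated X -> lattice_generated (conv_hull X).
Proof.
move=> XL; apply: conv_hull_min; first exact: convex_conv_hull.
apply: subset_trans XL _; apply: conv_hullS => x [Xx Lx]; split=> //.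
exact: sub_conv_hull.
Qed.

Lemma lattice_generated_slice n w h (P : set 'cV[rat]_n) :
  lattice_generated (slice w h P).
Proof.
apply: lattice_generated_conv_hull; apply: subset_trans (@sub_conv_hull _ _).
by move=> x [[]].
Qed.

Lemma lattice_generatedU n (X Y : set 'cV[rat]_n) :
  lattice_generated X -> lattice_generated Y -> lattice_generated (X `|` Y).
Proof.
move=> XL YL x [/XL|/YL]; apply: conv_hullS => y [Xy Ly]; split=> //.
  by left.
by right.
Qed.

Lemma lattice_generated_bigcup n I (D : set I) (X : I -> set 'cV[rat]_n) :
  (forall i, D i -> lattice_generated (X i)) ->
  lattice_generated (\bigcup_(i in D) X i).
Proof.
move=> XL x [i Di /(XL i Di)]; apply: conv_hullS => y [Xy Ly]; split=> //.
by exists i.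
Qed.

(** One summand is freed at a time: for a fixed [y], the [x] with [x + y] in the hull [M] form a
    convex set, so lattice points of [X] may be replaced by all of [X]; then likewise for [Y]. *)
Lemma lattice_generated_minkowski n (X Y : set 'cV[rat]_n) :
  lattice_generated X -> lattice_generated Y ->
  lattice_generated (Defs.minkowski X Y).
Proof.
move=> XL YL.
set M := conv_hull (Defs.minkowski X Y `&` @lattice_points n).
have cM : @convex_set rat 'cV[rat]_n M by exact: convex_conv_hull.
have LM x y : (X `&` @lattice_points n) x -> (Y `&` @lattice_points n) y ->
    M (x + y).
  move=> [Xx [u _ uE]] [Yy [v _ vE]]; apply: sub_conv_hull; split.
    by exists x => //; exists y.
  by exists (u + v) => //; rewrite map_mxD uE vE.
have LM' x y : X x -> (Y `&` @lattice_points n) y -> M (x + y).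
  move=> /XL Xx Yy.
  apply: (conv_hull_min _ _ Xx (C := (fun z => z + y) @^-1` M)).
    by apply: convex_preimage => //; exact: affine_addr.
  by move=> z Xz; exact: LM.
move=> _ [x Xx [y /YL Yy <-]]; rewrite -/M.
apply: (conv_hull_min _ _ Yy (C := (fun z => x + z) @^-1` M)).
  by apply: convex_preimage => //; exact: affine_addl.
by move=> z Yz; exact: LM'.
Qed.

Lemma lattice_generated_image m n (f : 'cV[rat]_m -> 'cV[rat]_n) X :
  affine_map f -> f @` @lattice_points m `<=` @lattice_points n ->
  lattice_generated X -> lattice_generated (f @` X).
Proof.
move=> af fL XL _ [x /XL Xx <-].
have /image_conv_hull : (f @` conv_hull (X `&` @lattice_points m)) (f x).
  by exists x.
move=> /(_ af); apply: conv_hullS => _ [y [Xy Ly] <-]; split; first by exists y.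
by apply: fL; exists y.
Qed.

Lemma lattice_generated_dilate n (k : int) (X : set 'cV[rat]_n) :
  lattice_generated X -> lattice_generated (dilate k X).
Proof.
apply: lattice_generated_image; first exact: affine_scale.
by move=> _ [_ [u _ <-] <-]; exists (k *: u) => //; rewrite map_mxZ.
Qed.

Lemma lattice_generated_mulmx m n (U : 'M[int]_(n, m)) (X : set 'cV[rat]_m) :
  lattice_generated X -> lattice_generated [set map_mx intr U *m x | x in X].
Proof.
apply: lattice_generated_image; first exact: affine_mulmx.
by move=> _ [_ [u _ <-] <-]; exists (U *m u) => //; rewrite map_mxM.
Qed.

(** * Boxes and finiteness of their lattice subsets *)

Definition box n (K : rat) : set 'cV[rat]_n :=
  [set x | forall i, `|x i 0| <= K].

Lemma convex_box n K : @convex_set rat 'cV[rat]_n (box K).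
Proof.
apply/convex_setP => x y t Bx By t01 i; rewrite !mxE.
move: (Bx i) (By i); rewrite !ler_norml => /andP[? ?] /andP[? ?].
by apply/andP; split; nra.
Qed.

Lemma finite_set_box n (A : set 'cV[rat]_n) :
  finite_set A -> exists K : nat, A `<=` box K%:R.
Proof.
move=> /finite_seqP[s ->].
exists (\max_(x <- s) \max_(i < n) (Num.truncn `|x i 0|%R).+1)%N => x /= xs i.
apply: le_trans (ltW (truncnS_gt _)) _; rewrite ler_nat.
by rewrite (leq_trans _ (leq_bigmax_seq _ xs isT))// leq_bigmax.
Qed.

Lemma polytope_box n (P : set 'cV[rat]_n) :
  polytope P -> exists K : nat, P `<=` box K%:R.
Proof.
move=> [A /finite_set_box[K AK] ->]; exists K.
by apply: conv_hull_min AK; exact: convex_box.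
Qed.

(** Adding [K] to each coordinate encodes the lattice points of the box as vectors over a finite
    ordinal type, and each [S] is the image under the decoding [g] of a finite set of codes. *)
Lemma finite_lattice_subsets_box n (K : nat) :
  finite_set [set S : set 'cV[rat]_n | S `<=` box K%:R `&` @lattice_points n].
Proof.
pose g (v : 'cV['I_(K.*2.+1)]_n) : 'cV[rat]_n := \col_i ((v i 0)%:R - K%:R).
apply: (@sub_finite_set _ _
  [set g @` [set` V] | V in [set: {set 'cV['I_(K.*2.+1)]_n}]]); last first.
  by apply: finite_image; exact: finite_finset.
move=> S SB /=; exists [set v | `[< S (g v) >]]%SET => //.
apply/seteqP; split=> [_ [v /= + <-]|x Sx].
  by rewrite inE => /asboolP.
have [Bx [u _ uE]] := SB _ Sx.
pose v : 'cV['I_(K.*2.+1)]_n := \col_i inord (absz (u i 0 + K%:Z)).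
suff gv : g v = x by exists v => //=; rewrite inE gv; apply/asboolP.
apply/matrixP => i j; rewrite !mxE ord1 -uE !mxE.
have := Bx i; rewrite -uE mxE -intr_norm.
rewrite -[K%:R]/(K%:Z%:~R) ler_int => uK.
rewrite inordK; last by lia.
rewrite [X in X - _]pmulrn gez0_abs; last by lia.
by rewrite rmorphD /= addrK.
Qed.

(** * Heights, slices and their extrema *)

Lemma pairingE n (w : 'rV[int]_n) x :
  pairing w x = \sum_i (w 0 i)%:~R * x i 0.
Proof. by rewrite /pairing !mxE; apply: eq_bigr => i _; rewrite !mxE. Qed.

Lemma pairingD n (w : 'rV[int]_n) x y :
  pairing w (x + y) = pairing w x + pairing w y.
Proof. by rewrite /pairing mulmxDr mxE. Qed.

Lemma pairingZ n (w : 'rV[int]_n) a x : pairing w (a *: x) = a * pairing w x.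
Proof. by rewrite /pairing -scalemxAr mxE. Qed.

Lemma pairingN n (w : 'rV[int]_n) x : pairing (- w) x = - pairing w x.
Proof. by rewrite /pairing map_mxN mulNmx mxE. Qed.

Lemma pairing_int n (w : 'rV[int]_n) v :
  pairing w (map_mx intr v) = ((w *m v) 0 0)%:~R.
Proof. by rewrite /pairing -map_mxM mxE. Qed.

Lemma convex_halfspace n (w : 'rV[int]_n) m :
  @convex_set rat 'cV[rat]_n [set x | m <= pairing w x].
Proof.
apply/convex_setP => x y t /= wx wy t01.
by rewrite pairingD !pairingZ; nra.
Qed.

Lemma convex_hyperplane n (w : 'rV[int]_n) h :
  @convex_set rat 'cV[rat]_n (hyperplane w h).
Proof.
apply/convex_setP => x y t; rewrite /hyperplane/= => wx wy _.
by rewrite pairingD !pairingZ wx wy; ring.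
Qed.

Lemma slice_hyperplane n (w : 'rV[int]_n) h P :
  slice w h P `<=` hyperplane w h.
Proof. by apply: conv_hull_min => [|x [[]]//]; exact: convex_hyperplane. Qed.

Lemma slice_sub n (w : 'rV[int]_n) h P :
  polytope P -> slice w h P `<=` P.
Proof.
move=> [A _ PE]; apply: conv_hull_min => [|x [[]]//].
by rewrite PE; exact: convex_conv_hull.
Qed.

Lemma seq_argmin (T : eqType) (f : T -> rat) (s : seq T) : s <> [::] ->
  exists2 x, x \in s & forall y, y \in s -> f x <= f y.
Proof.
elim: s => // a s IH _; have [->|/eqP/IH[x xs xmin]] := eqVneq s [::].
  by exists a; rewrite ?mem_head// => y; rewrite inE => /eqP ->.
have [ax|/ltW xa] := leP (f a) (f x).
  exists a; first exact: mem_head.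
  by move=> y; rewrite inE => /orP[/eqP ->//|/xmin]; exact: le_trans.
exists x; first by rewrite inE xs orbT.
by move=> y; rewrite inE => /orP[/eqP ->|/xmin].
Qed.

Lemma lattice_polytope_min n (w : 'rV[int]_n) (P : set 'cV[rat]_n) :
  lattice_polytope P -> P !=set0 ->
  exists2 v : 'cV[int]_n, vertices P (map_mx intr v) &
    forall x, P x -> pairing w (map_mx intr v) <= pairing w x.
Proof.
move=> /lattice_polytope_seq[S [PE P0 SP]] /set0P/eqP Pn0.
have [//|v vS vmin] := @seq_argmin _ (fun v => pairing w (map_mx intr v)) S.
  by move=> /P0.
exists v; first exact: SP.
rewrite PE; apply: conv_hull_min; first exact: convex_halfspace.
by move=> _ [u uS <-]; exact: vmin.
Qed.

(** A minimum value is unique, so [xget] returns it and not the default 0. *)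
Lemma h_minE n (w : 'rV[int]_n) P x : P x ->
  (forall y, P y -> pairing w x <= pairing w y) -> h_min w P = pairing w x.
Proof.
move=> Px xmin; apply: xget_unique.
  by split; [exists x|move=> _ [y Py <-]; exact: xmin].
move=> _ [[y Py <-] ymin]; apply/eqP; rewrite eq_le xmin// andbT.
by apply: ymin; exists x.
Qed.

Lemma h_maxE n (w : 'rV[int]_n) P x : P x ->
  (forall y, P y -> pairing w y <= pairing w x) -> h_max w P = pairing w x.
Proof.
move=> Px xmax; apply: xget_unique.
  by split; [exists x|move=> _ [y Py <-]; exact: xmax].
move=> _ [[y Py <-] ymax]; apply/eqP; rewrite eq_le xmax//=.
by apply: ymax; exists x.
Qed.

Lemma h_min_vertex n (w : 'rV[int]_n) (P : set 'cV[rat]_n) :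
  lattice_polytope P -> P !=set0 ->
  exists v : 'cV[int]_n, [/\ vertices P (map_mx intr v),
    h_min w P = pairing w (map_mx intr v) &
    forall x, P x -> h_min w P <= pairing w x].
Proof.
move=> latP Pn0; have [v vP vmin] := lattice_polytope_min w latP Pn0.
have hE : h_min w P = pairing w (map_mx intr v).
  by apply: h_minE; first case: vP.
by exists v; split => //; rewrite hE.
Qed.

Lemma h_max_attained n (w : 'rV[int]_n) (P : set 'cV[rat]_n) :
  lattice_polytope P -> P !=set0 ->
  (exists2 x, P x & h_max w P = pairing w x) /\
  forall x, P x -> pairing w x <= h_max w P.
Proof.
(* The maximum of [w] is attained where [- w] is minimal. *)
move=> latP Pn0; have [v vP vmin] := lattice_polytope_min (- w) latP Pn0.
have vmax x : P x -> pairing w x <= pairing w (map_mx intr v).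
  by move=> /vmin; rewrite !pairingN lerN2.
have hE : h_max w P = pairing w (map_mx intr v).
  by apply: h_maxE; first case: vP.
by split; [exists (map_mx intr v) => //; case: vP|rewrite hE].
Qed.

Lemma interior0_box n (P : set 'cV[rat]_n) :
  interior (P : set 'cV[rat^o]_n) 0 ->
  exists2 e : rat, 0 < e & box e `<=` P.
Proof.
(* Balls are open and boxes closed, hence the halved radius. *)
move=> /nbhs_ballP[e /= e0 eP]; exists (e / 2); first by rewrite divr_gt0.
move=> x xe; apply: eP; split=> // i j.
by rewrite -ball_normE /= mxE sub0r normrN ord1 (le_lt_trans (xe i))//; lra.
Qed.

(** * Unimodular maps and shears *)

Lemma iso_class_mulmx n (U : 'M[int]_n) (Q : set 'cV[rat]_n) :
  U \in unitmx -> iso_class [set map_mx intr U *m x | x in Q] = iso_class Q.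
Proof.
move=> Uu; apply/seteqP; split=> _ [M Mu <-].
  exists (M *m U); first by rewrite unitmx_mul Mu.
  apply/seteqP; split=> [_ [x Qx <-]|_ [_ [x Qx <-] <-]].
    by exists (map_mx intr U *m x); [exists x|rewrite map_mxM mulmxA].
  by exists x => //; rewrite map_mxM mulmxA.
exists (M *m invmx U); first by rewrite unitmx_mul Mu unitmx_inv.
apply/seteqP; split=> [_ [_ [x Qx <-] <-]|_ [x Qx <-]].
  by exists x => //; rewrite mulmxA -map_mxM mulmxKV.
exists (map_mx intr U *m x); first by exists x.
by rewrite mulmxA -map_mxM mulmxKV.
Qed.

(** Since [w *m f = 0], the matrix [f *m w] squares to zero, and [1%:M + f *m w] is the inverse. *)
Lemma unitmx_shear n (w : 'rV[int]_n) (f : 'cV[int]_n) :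
  w *m f = 0 -> 1%:M - f *m w \in unitmx.
Proof.
move=> wf.
suff /mulmx1_unit[] : (1%:M + f *m w) *m (1%:M - f *m w) = 1%:M by [].
rewrite mulmxDl mul1mx mulmxBr mulmx1 mulmxA -(mulmxA f) wf mulmx0 mul0mx.
by rewrite subr0 subrK.
Qed.

Lemma shearE n (w : 'rV[int]_n) (f : 'cV[int]_n) (x : 'cV[rat]_n) :
  map_mx intr (1%:M - f *m w) *m x = x - pairing w x *: map_mx intr f.
Proof.
rewrite map_mxB map_mx1 map_mxM mulmxBl mul1mx -mulmxA.
by rewrite [map_mx intr w *m x]mx11_scalar mul_mx_scalar.
Qed.

(** * Bounds on the pairing over boxes *)

(** The test points are plus and minus [e] times the [i]-th basis vector; both lie in the inner
    box. *)
Lemma box_pairing_bound n (w : 'rV[int]_n) (P : set 'cV[rat]_n) (e m : rat) i :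
  0 < e -> box e `<=` P -> (forall x, P x -> m <= pairing w x) ->
  m <= - (e * `|(w 0 i)%:~R|).
Proof.
move=> e0 eP mP.
have wE a : pairing w (a *: delta_mx i 0) = a * (w 0 i)%:~R.
  rewrite pairingE (bigD1 i)//= big1 => [|j ji].
    by rewrite !mxE !eqxx addr0 mulr1 mulrC.
  by rewrite !mxE (negPf ji) !mulr0.
have Pa a : `|a| <= e -> P (a *: delta_mx i 0).
  move=> ae; apply: eP => j; rewrite !mxE normrM.
  by case: (_ && _); rewrite ?normr1 ?normr0 ?mulr1 ?mulr0 ?(ltW e0).
have := mP _ (Pa e _); have := mP _ (Pa (- e) _).
rewrite !wE normrN ger0_norm ?(ltW e0)// => /(_ (lexx _)) h1 /(_ (lexx _)) h2.
have [wi|wi] := leP 0 ((w 0 i)%:~R : rat).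
  by rewrite (ger0_norm wi); lra.
by rewrite (ltr0_norm wi); lra.
Qed.

Lemma pairing_bound n (w : 'rV[int]_n) (W K : rat) (x : 'cV[rat]_n) :
  (forall i, `|(w 0 i)%:~R| <= W) -> box K x ->
  pairing w x <= n%:R * (W * K).
Proof.
move=> wW xK; rewrite pairingE; apply: le_trans (ler_norm _) _.
apply: le_trans (ler_norm_sum _ _ _) _.
apply: (@le_trans _ _ (\sum_(i < n) W * K)).
  by apply: ler_sum => i _; rewrite normrM ler_pM.
by rewrite sumr_const card_ord mulr_natl.
Qed.

(** * The sheared mutation *)

Section Mutation.
Variables (n : nat) (P F : set 'cV[rat]_n) (w : 'rV[int]_n).
Hypotheses (P_lattice : lattice_polytope P) (F_level : F `<=` hyperplane w 0).

Lemma compatible_slice h G x z :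
  compatible w P F h G -> G x -> F z -> slice w h P (x - h%:~R *: z).
Proof.
move=> [_ _ GF] Gx Fz; rewrite -scaleNr -rmorphN /=.
by apply: GF; exists x => //; exists ((- h)%:~R *: z) => //; exists z.
Qed.

(** Subtracting [h] times a point of [F], which has height 0, moves [x] into the slice without
    changing its height. *)
Lemma compatible_height h G x :
  compatible w P F h G -> F !=set0 -> G x -> pairing w x = h%:~R.
Proof.
move=> cG [z Fz] Gx; have := slice_hyperplane (compatible_slice cG Gx Fz).
by rewrite /hyperplane /= -scaleNr pairingD pairingZ (F_level Fz) mulr0 addr0.
Qed.

(** For [x] in [G], both [x - h u] and [x - h v] lie in [P], hence in the box. In a coordinate where
    the integer vectors [u] and [v] differ, these points are at least [|h|] apart. *)
Lemma compatible_height_bound h G (u v : 'cV[int]_n) (K : rat) :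
  compatible w P F h G -> G !=set0 -> P `<=` box K ->
  F (map_mx intr u) -> F (map_mx intr v) -> u != v ->
  `|h%:~R| <= 2 * K.
Proof.
move=> cG [x Gx] PK Fu Fv uv.
have [i uvi] : exists i, u i 0 != v i 0.
  apply/existsP; apply: contra_neqT uv; rewrite negb_exists => /forallP uv.
  by apply/matrixP => i j; rewrite ord1; apply/eqP; rewrite -[_ == _]negbK.
have Pz z : F z -> P (x - h%:~R *: z).
  move=> Fz; apply: (slice_sub _ (compatible_slice cG Gx Fz)).
  by case: P_lattice.
have := PK _ (Pz _ Fu) i; have := PK _ (Pz _ Fv) i; rewrite !mxE.
set a := x i 0 => xv xu.
have uv1 : (1 : rat) <= `|(u i 0)%:~R - (v i 0)%:~R|.
  by rewrite -rmorphB /= -intr_norm -[1]/(1%:Z%:~R) ler_int; lia.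
have : `|h%:~R * ((u i 0)%:~R - (v i 0)%:~R)| <= 2 * K.
  have -> : h%:~R * ((u i 0)%:~R - (v i 0)%:~R) =
    (a - h%:~R * (v i 0)%:~R) - (a - h%:~R * (u i 0)%:~R) by ring.
  by rewrite (le_trans (ler_normB _ _))//; lra.
by rewrite normrM => /(le_trans _); apply; rewrite ler_peMr.
Qed.

Variable G : int -> set 'cV[rat]_n.
Hypothesis G_compatible :
  forall h, neg_heights w P h -> compatible w P F h (G h).

Lemma lattice_generated_mut :
  lattice_polytope F -> lattice_generated (mut w P F G).
Proof.
move=> Flat; apply: lattice_generated_conv_hull; apply: lattice_generatedU.
  apply: lattice_generated_bigcup => h /G_compatible[Glat _ _].
  exact: lattice_polytope_generated.
apply: lattice_generated_bigcup => h _; apply: lattice_generated_minkowski.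
  exact: lattice_generated_slice.
by apply: lattice_generated_dilate; exact: lattice_polytope_generated.
Qed.

Variable f : 'cV[int]_n.
Hypothesis Ff : F (map_mx intr f).

Local Notation U := (map_mx intr (1%:M - f *m w) : 'M[rat]_n).

Lemma shear_slice h x z : slice w h P x -> F z ->
  U *m (x + h%:~R *: z) = x + h%:~R *: (z - map_mx intr f).
Proof.
move=> /slice_hyperplane wx Fz; rewrite shearE pairingD pairingZ wx.
by rewrite (F_level Fz) mulr0 addr0 scalerBr addrA.
Qed.

(** At a negative height the shear sends [x] in [G h] to [x - h f], a point of the slice and so of
    [P]; elsewhere [x + h z] goes to [x + h (z - f)]. The set [C] is later [P] itself or a box. *)
Lemma shear_mut_sub (C : set 'cV[rat]_n) :
  @convex_set rat 'cV[rat]_n C -> P `<=` C ->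
  (forall h x z, nonneg_heights w P h -> P x -> F z ->
    C (x + h%:~R *: (z - map_mx intr f))) ->
  [set U *m x | x in mut w P F G] `<=` C.
Proof.
move=> cC PC C_pos _ [x Qx <-]; move: x Qx.
apply: (@conv_hull_min _ _ ([eta mulmx U] @^-1` C))
  => [|x [[h hneg Gx]|[h hpos]]].
- by apply: convex_preimage cC; exact: affine_mulmx.
- have cG := G_compatible hneg; have F0 : F !=set0 by exists (map_mx intr f).
  rewrite /preimage /= shearE (compatible_height cG F0 Gx); apply: PC.
  apply: (@slice_sub _ w h); first by case: P_lattice.
  exact: compatible_slice cG Gx Ff.
- move=> [y sy [_ [z Fz <-] <-]]; rewrite /preimage /= shear_slice//.
  by apply: C_pos => //; apply: slice_sub sy; case: P_lattice.
Qed.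

(** For the inclusion of [P], each generating vertex [v] of height [h] is the image of [v + h f],
    and it remains to find this point in the mutation. *)
Lemma shear_mut_point : F `<=` [set map_mx intr f] -> P !=set0 ->
  [set U *m x | x in mut w P F G] = P.
Proof.
move=> FE Pn0; have [S [PE _ SP]] := lattice_polytope_seq P_lattice.
apply/seteqP; split.
  apply: shear_mut_sub => // [|h x z _ Px /FE ->].
    by rewrite PE; exact: convex_conv_hull.
  by rewrite subrr scaler0 addr0.
rewrite {1}PE; apply: conv_hull_min.
  by apply: convex_image; [exact: affine_mulmx|exact: convex_conv_hull].
move=> _ [v /SP vP <-]; have [Pv _] := vP.
pose h := (w *m v) 0 0.
have wv : pairing w (map_mx intr v) = h%:~R by exact: pairing_int.
exists (map_mx intr v + h%:~R *: map_mx intr f); last first.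
  rewrite shearE pairingD pairingZ (F_level Ff) wv mulr0 addr0.
  by rewrite addrK.
apply: sub_conv_hull; have [h0|h0] := ltP h 0.
  have hneg : neg_heights w P h.
    have [_ [_ _ hmin]] := h_min_vertex w P_lattice Pn0.
    by split; rewrite -?wv ?hmin.
  (* The covering of vertices writes [v] as [x - h f] with [x] in [G h], so [v + h f] is [x]. *)
  left; exists h => //; have [_ + _] := G_compatible hneg.
  move=> /(_ _ (conj wv vP))[x Gx [_ [_ /FE -> <-] <-]].
  by rewrite -addrA -scalerDl rmorphN /= addNr scale0r addr0.
right; exists h.
  have [_ hmax] := h_max_attained w P_lattice Pn0.
  by split; rewrite -?wv ?hmax.
exists (map_mx intr v).
  by apply: sub_conv_hull; split; [split|exists v].
by exists (h%:~R *: map_mx intr f) => //; exists (map_mx intr f).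
Qed.

End Mutation.

(** * Uniform bounds and finiteness *)

(** Controls the two quantities in a sheared point [z + h (x - v)]: the height [h] and the
    difference [x - v]. *)
Lemma factor_heights_bound n (P F : set 'cV[rat]_n) (w : 'rV[int]_n)
    (u v : 'cV[int]_n) (e K : rat) :
  lattice_polytope P -> 0 < e -> box e `<=` P -> P `<=` box K ->
  w != 0 -> is_factor w P F ->
  F (map_mx intr u) -> F (map_mx intr v) -> u != v ->
  (forall i, `|(w 0 i)%:~R| <= 2 * K / e) /\
  (forall h x, nonneg_heights w P h -> F x ->
     `|h%:~R| <= n%:R * (2 * K / e * K) /\ box (2 * K) (x - map_mx intr v)).
Proof.
move=> Plat e0 eP PK w0 [_ _ Flev Fac] Fu Fv uv.
have P0 : P 0 by apply: eP => i; rewrite mxE normr0 ltW.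
have Pn0 : P !=set0 by exists 0.
have [m [mP hE hmin]] := h_min_vertex w Plat Pn0.
have wbound i := box_pairing_bound i e0 eP hmin.
have [i wi] : exists i, w 0 i != 0.
  apply/existsP; apply: contra_neqT w0; rewrite negb_exists => /forallP w0.
  by apply/matrixP => j i; rewrite ord1 mxE; apply/eqP; rewrite -[_ == _]negbK.
pose h := (w *m m) 0 0.
have hE' : h_min w P = h%:~R by rewrite hE pairing_int.
(* A nonzero entry of [w] and the inner box force the minimum below 0, so the factor condition
   applies at this height. *)
have hlt0 : h%:~R < (0 : rat).
  rewrite -hE'; apply: le_lt_trans (wbound i) _.
  by rewrite oppr_lt0 mulr_gt0// normr_gt0 intr_eq0.
have hneg : neg_heights w P h.
  by split; [rewrite hE'|rewrite -(ltr_int rat)].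
have [Gh cG] := Fac _ hneg; have [_ Gv GF] := cG.
(* The vertex [m] attaining the minimum has to be covered, so [Gh] is nonempty. *)
have [y Gy _] : Defs.minkowski Gh (dilate (- h) F) (map_mx intr m).
  by apply: Gv; split => //; rewrite /hyperplane /= -hE hE'.
have hbound : `|h%:~R| <= 2 * K.
  by apply: (compatible_height_bound Plat cG _ PK Fu Fv uv); exists y.
have wle j : `|(w 0 j)%:~R| <= 2 * K / e.
  rewrite ler_pdivlMr// mulrC; have := wbound j; rewrite hE' => wj.
  by rewrite ltr0_norm// in hbound; lra.
split=> // k x [k0 kle] Fx; split.
  have [[z Pz hz] _] := h_max_attained w Plat Pn0.
  rewrite ger0_norm ?ler0z//; apply: le_trans kle _; rewrite hz.
  by apply: pairing_bound => //; exact: PK.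
have Pz z : F z -> box K (y - h%:~R *: z).
  move=> Fz; apply: PK; apply: (slice_sub _ (compatible_slice cG Gy Fz)).
  by case: Plat.
move=> j; have := Pz _ Fx j; have := Pz _ Fv j; rewrite !mxE.
set a := y j 0; set b := x j 0; set c := (v j 0)%:~R => vK xK.
(* As [h] is a negative integer, a bound on [h (b - c)] also bounds [b - c]. *)
have h1 : 1 <= `|h%:~R : rat|.
  by rewrite -intr_norm -[1]/(1%:Z%:~R) ler_int; move: hlt0; rewrite ltrz0; lia.
have : `|h%:~R * (b - c)| <= 2 * K.
  have -> : h%:~R * (b - c) = (a - h%:~R * c) - (a - h%:~R * b) by ring.
  by rewrite (le_trans (ler_normB _ _))//; lra.
by rewrite normrM => /(le_trans _); apply; rewrite ler_peMl.
Qed.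

(* The library puts the topology of the absolute value on the alias rat^o. *)
Theorem proposition3 (n : nat) (P : set 'cV[rat]_n)
    (P_lattice_polytope : lattice_polytope P)
    (P_interior0 : interior (P : set 'cV[rat^o]_n) 0) :
  finite_set [set iso_class Q | Q in mutations P].
Proof.
have [Ppoly _] := P_lattice_polytope.
have [K PK] := polytope_box Ppoly.
have [e e0 eP] := interior0_box P_interior0.
have P0 : P 0 by apply: eP => i; rewrite mxE normr0 ltW.
(* [B] bounds the entries of [x + h (z - f)]: [K] for [x] in [P], then the bound on [h] times the
   bound [2 K] on [z - f]. *)
pose B : rat := K%:R + n%:R * (2 * K%:R / e * K%:R) * (2 * K%:R).
pose KB := (Num.truncn B).+1.
apply: (@sub_finite_set _ _ ([set iso_class P] `|`
  [set iso_class (conv_hull S) | S in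
    [set S : set 'cV[rat]_n | S `<=` box KB%:R `&` @lattice_points n]])).
  move=> _ [Q [w [F [G [[w0 _] Fac Gcomp ->]]]] <-].
  have [Flat [x Fx] Flev _] := Fac.
  have [T [FE F0 TF]] := lattice_polytope_seq Flat.
  case: T => [|f T] in FE F0 TF.
    by have F0' : F = set0; [exact/F0|rewrite F0' in Fx].
  have Ff : F (map_mx intr f) by have [] := TF f (mem_head _ _).
  have wf : w *m f = 0.
    apply/matrixP => i j; rewrite !ord1 [RHS]mxE; apply/eqP.
    by rewrite -(intr_eq0 rat) -pairing_int; apply/eqP/(Flev _ Ff).
  have Uu := unitmx_shear wf.
  (* The mutation is replaced by its sheared image, which has the same class. *)
  rewrite -(iso_class_mulmx (mut w P F G) Uu).
  have [[u uT uf]|Tf] := pselect (exists2 u, u \in f :: T & u != f); last first.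
    left; congr iso_class; apply: shear_mut_point => //; last by exists 0.
    rewrite FE; apply: conv_hull_min; first exact: convex_set1.
    move=> _ [u uT <-] /=; congr map_mx; apply/eqP.
    by apply: contra_notT Tf => uf; exists u.
  right; set Q' := [set _ *m _ | _ in mut w P F G].
  (* Thus the class of [Q'] is that of a hull of lattice points, and only the box bound remains. *)
  have Q'E : Q' = conv_hull (Q' `&` @lattice_points n).
    apply/seteqP; split.
      apply: (@lattice_generated_mulmx n n (1%:M - f *m w)).
      exact: lattice_generated_mut Gcomp Flat.
    apply: conv_hull_min => [|y []//].
    by apply: convex_image; [exact: affine_mulmx|exact: convex_conv_hull].
  exists (Q' `&` @lattice_points n); last by rewrite -Q'E.
  move=> y [Q'y Ly]; split=> //.
  have Fu : F (map_mx intr u) by have [] := TF u uT.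
  have [wW hB] :=
    factor_heights_bound P_lattice_polytope e0 eP PK w0 Fac Fu Ff uf.
  have H0 : 0 <= n%:R * (2 * K%:R / e * K%:R).
    do 2![apply: mulr_ge0 => //]; apply: divr_ge0; last exact: ltW.
    exact: mulr_ge0.
  have BKB : B <= KB%:R by rewrite ltW// truncnS_gt.
  suff Q'B : Q' `<=` box KB%:R by exact: Q'B.
  apply: (shear_mut_sub P_lattice_polytope Flev Gcomp Ff).
  - exact: convex_box.
  - move=> z /PK zK i; apply: le_trans (zK i) (le_trans _ BKB).
    by rewrite lerDl mulr_ge0// mulr_ge0.
  - move=> h z t hpos /PK zK Ft i; apply: le_trans BKB; rewrite mxE.
    have [hh tt] := hB h t hpos Ft; apply: le_trans (ler_normD _ _) _.
    by apply: lerD => //; rewrite mxE normrM ler_pM.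
rewrite finite_setU; split; first exact: finite_set1.
exact/finite_image/finite_lattice_subsets_box.
Qed.
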